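(* Let $p$ be a prime and $n\ge1$ an integer. Let $\widetilde G$ be the group generated by $\sigma_1,\sigma_2,\sigma_3,\sigma_4$ with $Z(\widetilde G)=[\widetilde G,\widetilde G]$ and relations $\sigma_i^{p^n}=1$ for $1\le i\le 4$ and $[\sigma_i,\sigma_j]^{p^n}=1$ for $1\le i<j\le 4$ (the Schur covering group of $C_{p^n}^4$). Let $H$ be the cyclic subgroup of $\widetilde G$ generated by $[\sigma_1,\sigma_2][\sigma_3,\sigma_4]$, and $G=\widetilde G/H$. Then $B_0(G)$ contains a subgroup isomorphic to $\mathbf{Z}/p^n\mathbf{Z}$.
   Context: Commutators are $[g,h]=ghg^{-1}h^{-1}$; $Z(\cdot)$ denotes the center; $C_m$ is the cyclic group of order $m$. $\mathbf{Q}/\mathbf{Z}$ has trivial group action. A group is bicyclic if it is cyclic or a direct product of two cyclic groups. The Bogomolov multiplier of a finite group $G$ is $B_0(G)=\bigcap_A \operatorname{Ker}\{\operatorname{res}_G^A: H^2(G,\mathbf{Q}/\mathbf{Z})\to H^2(A,\mathbf{Q}/\mathbf{Z})\}$, $A$ running over all bicyclic subgroups of $G$. *)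

(* Defs.v *)
From mathcomp Require Import all_boot all_order all_algebra all_fingroup all_solvable.
Set Implicit Arguments.
Unset Strict Implicit.
Unset Printing Implicit Defensive.
Import GRing.Theory Num.Theory.

(* Q/Z-valued cochains with trivial action are represented by Q-valued lifts:
   every condition is imposed modulo Z, i.e. "is an integer" (denq q == 1). *)
Definition intq (q : rat) : bool := denq q == 1%Z.

Local Open Scope ring_scope.

Definition cocycle2 (gT : finGroupType) (G : {set gT}) (f : gT -> gT -> rat) :=
  forall g h k, g \in G -> h \in G -> k \in G ->
    intq (f h k - f (g * h)%g k + f g (h * k)%g - f g h).

Definition coboundary2_on (gT : finGroupType) (A : {set gT}) (f : gT -> gT -> rat) :=
  exists c : gT -> rat, forall g h, g \in A -> h \in A ->
    intq (f g h - (c h - c (g * h)%g + c g)).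

Definition bicyclic (gT : finGroupType) (A : {set gT}) :=
  exists x y : gT, (<[x]> \x <[y]>)%g = A.

Definition in_B0 (gT : finGroupType) (G : {group gT}) (f : gT -> gT -> rat) :=
  cocycle2 G f /\
  forall A : {group gT}, A \subset G -> bicyclic A -> coboundary2_on A f.

Definition class_order (gT : finGroupType) (G : {set gT}) (f : gT -> gT -> rat)
    (m : nat) :=
  coboundary2_on G (fun g h => (f g h) *+ m) /\
  forall k : nat, (0 < k < m)%N -> ~ coboundary2_on G (fun g h => (f g h) *+ k).

Definition B0_has_cyclic (gT : finGroupType) (G : {group gT}) (m : nat) :=
  exists f : gT -> gT -> rat, in_B0 G f /\ class_order G f m.

Local Open Scope group_scope.

Definition schur_rels (gT : finGroupType) (q : nat) (s1 s2 s3 s4 : gT) :=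
  [/\ s1 ^+ q = 1, s2 ^+ q = 1, s3 ^+ q = 1 & s4 ^+ q = 1] /\
  [/\ [~ s1, s2] ^+ q = 1, [~ s1, s3] ^+ q = 1, [~ s1, s4] ^+ q = 1,
      [~ s2, s3] ^+ q = 1 & [~ s2, s4] ^+ q = 1] /\ [~ s3, s4] ^+ q = 1.

(* Main.v *)
(* Let q = p^n and let chi be the faithful character of H = <c> with values in
   Q/Z.  Pushing the extension 1 -> H -> Gt -> G -> 1 along chi gives a class of
   H^2(G, Q/Z); k times this class vanishes iff k chi extends to Gt, which forces
   k chi (c) = 0 because c is a product of commutators, so the order is #[c] = q.
   The commutator pairing of Gt is x, y |-> x /\ y on (Z/q)^4, and no nonzero
   multiple of e1 /\ e2 + e3 /\ e4 is decomposable over Z/q.  Hence elements of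
   Gt that commute modulo H commute, abelian subgroups of G have abelian
   preimages in Gt, and chi extends to these since Q/Z is injective; the class is
   therefore trivial on every abelian subgroup of G. *)
Require Import Defs.
From mathcomp Require Import all_boot all_order all_algebra all_fingroup all_solvable.
From HB Require Import structures.
From mathcomp Require Import ring.
Set Implicit Arguments.
Unset Strict Implicit.
Unset Printing Implicit Defensive.

(** * Decomposable bivectors modulo prime powers *)

Section Arithmetic.

Import GRing.Theory Num.Theory.
Local Open Scope ring_scope.

(** Passes from ['Z_q] to integers, where the descent below can divide by [p]. The bound on [q]
    matters because ['Z_0] and ['Z_1] have two elements. *)
Lemma intr_Zp_eq0 (q : nat) (z : int) :
  (1 < q)%N -> ((z%:~R : 'Z_q) == 0) = (q %| z)%Z.
Proof.
move=> q_gt1; have natE (m : nat) : ((m%:R : 'Z_q) == 0) = (q %| m)%N.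
  by rewrite -val_eqE /= val_Zp_nat.
by case: z => m; rewrite ?NegzE ?mulrNz ?oppr_eq0 ?rpredN; apply: natE.
Qed.

Definition o4 (i : nat) : 'I_4 := inord i.

(* By the Pluecker relation, k^2 Pf(w) = 0 modulo p, so p divides k and x, y are
   dependent modulo p; replacing (x, y) by a basis with a vector divisible by p
   lowers n by one. *)
Lemma decomposable_multiple (p n : nat) (w : 'I_4 -> 'I_4 -> int)
    (x y : 'I_4 -> int) (k : int) :
  prime p ->
  ~~ (p %| w (o4 0) (o4 1) * w (o4 2) (o4 3) - w (o4 0) (o4 2) * w (o4 1) (o4 3)
           + w (o4 0) (o4 3) * w (o4 1) (o4 2))%Z ->
  (forall i j : 'I_4, (i < j)%N ->
     ((p ^ n)%N %| x i * y j - x j * y i - k * w i j)%Z) ->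
  ((p ^ n)%N %| k)%Z.
Proof.
move=> p_pr Pf_w; elim: n x y k => [|n IHn] x y k wedge_xy.
  by rewrite expn0 dvd1z.
have p_neq0 : (p : int) != 0 by rewrite -lt0n prime_gt0.
have pM a b : (p %| a * b)%Z = (p %| a)%Z || (p %| b)%Z.
  by rewrite !dvdzE abszM Euclid_dvdM.
have pdvd (i j : 'I_4) : (i < j)%N -> (p %| x i * y j - x j * y i - k * w i j)%Z.
  by move=> /wedge_xy; apply: dvdz_trans; rewrite expnS PoszM dvdz_mulr.
have p_k : (p %| k)%Z.
  have E i j : (i < j < 4)%N -> exists e : int, k * w (o4 i) (o4 j) =
      x (o4 i) * y (o4 j) - x (o4 j) * y (o4 i) - e * p.
    case/andP=> ij j4; have lt : (o4 i < o4 j)%N.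
      by rewrite !inordK // (ltn_trans ij).
    by have /dvdzP[e De] := pdvd _ _ lt; exists e; rewrite -De; ring.
  have [e01 E01] := E 0 1 isT; have [e23 E23] := E 2 3 isT.
  have [e02 E02] := E 0 2 isT; have [e13 E13] := E 1 3 isT.
  have [e03 E03] := E 0 3 isT; have [e12 E12] := E 1 2 isT.
  set Pf := (X in ~~ (_ %| X)%Z) in Pf_w.
  have : (p %| k * (k * Pf))%Z.
    have -> : k * (k * Pf) =
        (k * w (o4 0) (o4 1)) * (k * w (o4 2) (o4 3))
      - (k * w (o4 0) (o4 2)) * (k * w (o4 1) (o4 3))
      + (k * w (o4 0) (o4 3)) * (k * w (o4 1) (o4 2)) by rewrite /Pf; ring.
    rewrite {}E01 {}E23 {}E02 {}E13 {}E03 {}E12.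
    move: (o4 0) (o4 1) (o4 2) (o4 3) => i0 i1 i2 i3.
    (* After expansion, the terms free of [p] cancel by the Pluecker relation for [x] and [y]; the
       witness is what remains, divided by [p]. *)
    apply/dvdzP; exists (
       - (x i0 * y i1 - x i1 * y i0) * e23 - (x i2 * y i3 - x i3 * y i2) * e01
       + (x i0 * y i2 - x i2 * y i0) * e13 + (x i1 * y i3 - x i3 * y i1) * e02
       - (x i0 * y i3 - x i3 * y i0) * e12 - (x i1 * y i2 - x i2 * y i1) * e03
       + (e01 * e23 - e02 * e13 + e03 * e12) * p).
    ring.
  by rewrite !pM (negPf Pf_w) orbF orbb.
have {}pdvd i j : (p %| x i * y j - x j * y i)%Z.
  have pkw a b : (p %| k * w a b)%Z by rewrite dvdz_mulr.
  case: (ltngtP i j) => [ij|ji|/val_inj->].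
  - by rewrite -(subrK (k * w i j) (_ - _)) rpredD ?pdvd.
  - by rewrite -rpredN opprB -(subrK (k * w j i) (_ - _)) rpredD ?pdvd.
  - by rewrite subrr.
case/dvdzP: p_k wedge_xy => k' ->; rewrite mulrC => wedge_xy.
(* Once a factor [p] is extracted from the bivector, the induction hypothesis applies to [k'] with
   exponent [n]. *)
suff [x' [y' Exy]] : exists (x' y' : 'I_4 -> int),
    forall i j, x i * y j - x j * y i = (p : int) * (x' i * y' j - x' j * y' i).
  rewrite expnS PoszM dvdz_mul2l //; apply: (IHn x' y') => i j /wedge_xy.
  by rewrite Exy -mulrA -mulrBr expnS PoszM dvdz_mul2l.
(* Either [x] itself can be divided by [p], or some coordinate of [x] is invertible modulo [p]. *)
have [/forallP px | /forallPn[i px]] := boolP [forall i, p %| x i]%Z.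
  pose x' i := (x i %/ p)%Z.
  have Dx i : x i = x' i * p by rewrite divzK ?px.
  by exists x', y => i j; rewrite !Dx; ring.
have [u [v Euv]] := Bezoutz (x i) p.
have {}Euv : u * x i + v * p = 1.
  rewrite Euv; apply/eqP; rewrite -[_ == _]/(coprimez _ _) coprimezE /=.
  by rewrite coprime_sym prime_coprime // -dvdzE.
(* As [u] inverts [x i] modulo [p], [l] is the ratio of [y] to [x] modulo [p]; subtracting [l * x]
   from [y] leaves the bivector unchanged. *)
pose l := u * y i; pose y' j := ((y j - l * x j) %/ p)%Z.
have Dy j : y j = l * x j + y' j * p.
  rewrite divzK; first by ring.
  have -> : y j - l * x j = v * y j * p + u * (x i * y j - x j * y i).
    by rewrite -{1}[y j]mul1r -Euv /l; ring.
  by rewrite rpredD ?dvdz_mull ?dvdzz.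
by exists x, y' => a b; rewrite !Dy; ring.
Qed.

End Arithmetic.

(** * A concrete class-two group with commutators in the exterior square *)

Section Model.

Import GRing.Theory Num.Theory.
Local Open Scope ring_scope.

Variable q : nat.

(** The strictly upper half of the tensor product of [a] and [b]. Being bilinear it is a 2-cocycle,
    and [upper a b - upper b a] lists the Pluecker coordinates of the wedge of [a] and [b]. *)
Definition upper (a b : 'rV['Z_q]_4) : 'M['Z_q]_4 :=
  \matrix_(i, j) (if (i < j)%N then a 0 i * b 0 j else 0).

Lemma upperDl b : {morph upper^~ b : a a' / a + a'}.
Proof.
by move=> a a'; apply/matrixP=> i j; rewrite !mxE; case: ifP; rewrite ?addr0 // mulrDl.
Qed.

Lemma upperDr a : {morph upper a : b b' / b + b'}.
Proof.
by move=> b b'; apply/matrixP=> i j; rewrite !mxE; case: ifP; rewrite ?addr0 // mulrDr.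
Qed.

Lemma upper0 a : upper 0 a = 0.
Proof. by apply/matrixP=> i j; rewrite !mxE mul0r if_same. Qed.

Lemma upper0r a : upper a 0 = 0.
Proof. by apply/matrixP=> i j; rewrite !mxE mulr0 if_same. Qed.

Lemma upperNl a b : upper (- a) b = - upper a b.
Proof. by apply/eqP; rewrite -addr_eq0 -upperDl addNr upper0. Qed.

Lemma upperNr a b : upper a (- b) = - upper a b.
Proof. by apply/eqP; rewrite -addr_eq0 -upperDr addNr upper0r. Qed.

(* The covering group of (Z/q)^4: commutators take values in the strictly upper
   triangular matrices, playing the role of the exterior square. *)
Definition schur_cover : Type := ('rV['Z_q]_4 * 'M['Z_q]_4)%type.
HB.instance Definition _ := Finite.on schur_cover.

Definition cover_mul (x y : schur_cover) : schur_cover :=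
  (x.1 + y.1, x.2 + y.2 + upper x.1 y.1).
Definition cover_inv (x : schur_cover) : schur_cover := (- x.1, - x.2 + upper x.1 x.1).

Lemma cover_mulA : associative cover_mul.
Proof.
move=> x y z; rewrite /cover_mul /= addrA; congr pair.
by rewrite upperDl upperDr !addrA [LHS](ACl (1*2*5*3*6*4)).
Qed.

Lemma cover_mul1 : left_id (0, 0) cover_mul.
Proof. by case=> a A; rewrite /cover_mul /= !add0r upper0 addr0. Qed.

Lemma cover_mulV : left_inverse (0, 0) cover_inv cover_mul.
Proof.
case=> a A; rewrite /cover_mul /cover_inv /= addNr upperNl.
by congr pair; rewrite addrAC addrK addNr.
Qed.

HB.instance Definition _ :=
  Finite_isGroup.Build schur_cover cover_mulA cover_mul1 cover_mulV.

Lemma cover_mulE (x y : schur_cover) :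
  (x * y)%g = (x.1 + y.1, x.2 + y.2 + upper x.1 y.1) :> schur_cover.
Proof. by []. Qed.

(** Solving this equation for [w] gives the commutator without expanding any inverse. *)
Lemma cover_commE (x y w : schur_cover) :
  (y * x * w)%g = (x * y)%g -> w = (0, upper x.1 y.1 - upper y.1 x.1) :> schur_cover.
Proof.
case: w => a A; rewrite !cover_mulE /= => -[Ea EA].
have a0 : a = 0 by apply: (addrI (y.1 + x.1)); rewrite addr0 Ea addrC.
rewrite a0 upper0r addr0 in EA *; congr pair.
apply: (addrI (y.2 + x.2 + upper y.1 x.1)); rewrite EA.
by rewrite [RHS]addrA addrAC addrK (addrC x.2).
Qed.

Lemma cover_comm (x y : schur_cover) :
  [~ x, y]%g = (0, upper x.1 y.1 - upper y.1 x.1) :> schur_cover.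
Proof. by apply: cover_commE; rewrite -commgC. Qed.

(** This is [[~ x^-1, y^-1]]; by bilinearity the two signs cancel, so both commutator conventions
    agree. *)
Lemma cover_commV (x y : schur_cover) :
  (x * y * x^-1 * y^-1)%g = (0, upper x.1 y.1 - upper y.1 x.1) :> schur_cover.
Proof.
have <- : [~ x^-1, y^-1]%g = (x * y * x^-1 * y^-1)%g.
  by rewrite commgEl conjgE !invgK !mulgA.
by rewrite cover_comm /= !upperNl !upperNr !opprK.
Qed.

(** In general the second component also contains [upper a a] with coefficient [m] choose 2; the
    hypothesis removes this term. *)
Lemma cover_expg a A m : upper a a = 0 ->
  (((a, A) : schur_cover) ^+ m)%g = (a *+ m, A *+ m) :> schur_cover.
Proof.
move=> a0; elim: m => [|m IHm]; first by rewrite expg0.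
rewrite expgSr IHm cover_mulE /= -!mulrSr.
suff -> : upper (a *+ m) a = 0 by rewrite addr0.
by elim: m {IHm} => [|m IHm]; rewrite ?upper0 // mulrS upperDl a0 add0r.
Qed.

Lemma cover_expq a A : (1 < q)%N -> upper a a = 0 ->
  (((a, A) : schur_cover) ^+ q)%g = 1%g :> schur_cover.
Proof.
move=> q_gt1 a0; rewrite cover_expg //.
by congr pair; apply/matrixP=> i j; rewrite mulmxnE mxE -mulr_natr pchar_Zp ?mulr0.
Qed.

Lemma cover_comm3 (x y z : schur_cover) : [~ x, y, z]%g = 1%g.
Proof. by rewrite !cover_comm /= upper0 upper0r subrr. Qed.

Definition cover_gen (i : 'I_4) : schur_cover := (delta_mx 0 i, 0).

Lemma upper_gen (a b i j : 'I_4) :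
  upper (cover_gen a).1 (cover_gen b).1 i j = [&& i < j, i == a & j == b]%N%:R.
Proof. by rewrite !mxE /=; case: ltnP => // _; rewrite -natrM mulnb. Qed.

(** Keeping only entries strictly above the diagonal lets the generators have [q]-th power 1 even
    when [q] is even. *)
Lemma upper_gen_diag (a : 'I_4) : upper (cover_gen a).1 (cover_gen a).1 = 0.
Proof.
apply/matrixP=> i j; rewrite upper_gen mxE; case: and3P => // -[lt_ij /eqP ia /eqP ja].
by rewrite ia ja ltnn in lt_ij.
Qed.

Lemma cover_gen_rels (a b c d : 'I_4) : (1 < q)%N ->
  schur_rels q (cover_gen a) (cover_gen b) (cover_gen c) (cover_gen d).
Proof.
move=> q_gt1; have comm_expq (x y : schur_cover) : ([~ x, y] ^+ q)%g = 1%g.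
  by rewrite cover_comm cover_expq // upper0.
by split; [split; apply: cover_expq (upper_gen_diag _) | split].
Qed.

End Model.

(** * Characters with values in Q/Z and their extension *)

Section Cohomology.

Import GRing.Theory Num.Theory.
Local Open Scope ring_scope.

Lemma intqE (x : rat) : intq x = (x \is a Num.int).
Proof. by rewrite Qint_def. Qed.

(** A rational lift of a character to Q/Z: additivity holds modulo integers, and [chi 1] is an
    integer but need not be 0. *)
Definition qz_hom (gT : finGroupType) (A : {set gT}) (chi : gT -> rat) :=
  {in A &, forall x y, intq (chi (x * y)%g - chi x - chi y)}.

Section QZHomTheory.

Variables (gT : finGroupType) (A : {group gT}) (chi : gT -> rat).
Hypothesis chiM : qz_hom A chi.

Lemma qz_hom1 : intq (chi 1%g).
Proof.
have := chiM (group1 A) (group1 A).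
by rewrite mulg1 subrr sub0r !intqE rpredN.
Qed.

Lemma qz_homX x m : x \in A -> intq (chi (x ^+ m)%g - chi x *+ m).
Proof.
move=> Ax; elim: m => [|m]; first by rewrite expg0 mulr0n subr0 qz_hom1.
have := chiM (groupX m Ax) Ax; rewrite -expgSr !intqE => hM hX.
have -> : chi (x ^+ m.+1)%g - chi x *+ m.+1 = (chi (x ^+ m.+1)%g
    - chi (x ^+ m)%g - chi x) + (chi (x ^+ m)%g - chi x *+ m).
  by rewrite mulrSr; ring.
exact: rpredD.
Qed.

Lemma qz_homV x : x \in A -> intq (chi x^-1%g + chi x).
Proof.
move=> Ax; have := chiM Ax (groupVr Ax); have := qz_hom1.
rewrite mulgV !intqE => h1 h2; rewrite -(opprK (chi 1%g)) in h2.
have -> : chi x^-1%g + chi x = chi 1%g - (- - chi 1%g - chi x - chi x^-1%g).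
  ring.
exact: rpredB.
Qed.

End QZHomTheory.

Lemma qz_hom_comm (gT : finGroupType) (A : {group gT}) chi x y :
  qz_hom A chi -> x \in A -> y \in A -> intq (chi (x * y * x^-1 * y^-1)%g).
Proof.
move=> chiM Ax Ay; have hxy := chiM _ _ Ax Ay; have hyx := chiM _ _ Ay Ax.
have Axy := groupM Ax Ay; have Ayx := groupM Ay Ax.
have hV := qz_homV chiM Ayx; have := chiM _ _ Axy (groupVr Ayx).
move: hxy hyx hV; rewrite invMg mulgA !intqE => h1 h2 h3 h4.
have -> : chi (x * y * x^-1 * y^-1)%g =
   (chi (x * y * x^-1 * y^-1)%g - chi (x * y)%g - chi (x^-1 * y^-1)%g)
   + (chi (x * y)%g - chi x - chi y) - (chi (y * x)%g - chi y - chi x)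
   + (chi (x^-1 * y^-1)%g + chi (y * x)%g) by ring.
by rewrite rpredD // rpredB // rpredD.
Qed.

Lemma qz_homM_intq (gT : finGroupType) (A : {group gT}) chi x y :
  qz_hom A chi -> x \in A -> y \in A -> intq (chi x) -> intq (chi y) ->
  intq (chi (x * y)%g).
Proof.
move=> chiM Ax Ay; have := chiM _ _ Ax Ay; rewrite !intqE => h1 h2 h3.
by rewrite -(subrK (chi x) (chi _)) rpredD // -(subrK (chi y) (_ - _)) rpredD.
Qed.

(** Here [m] is the order of [x] modulo [B]. Setting the value at [x] to [chi (x ^+ m) / m] is
    compatible with [chi] on the powers of [x] lying in [B]. *)
Lemma qz_hom_extend1 (gT : finGroupType) (B : {group gT}) (chi : gT -> rat)
    (x : gT) (m : nat) :
  qz_hom B chi -> x \in 'C(B)%g -> (0 < m)%N ->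
  (forall i, ((x ^+ i)%g \in B) = (m %| i)%N) ->
  exists psi, [/\ qz_hom (<[x]> * B)%g psi,
    {in B, forall b, intq (psi b - chi b)} &
    intq (psi x - chi (x ^+ m)%g / m%:R)].
Proof.
move=> chiM cBx m_gt0 Bx.
pose t : rat := chi (x ^+ m)%g / m%:R.
have m_neq0 : m%:R != 0 :> rat by rewrite pnatr_eq0 -lt0n.
have Bxm : (x ^+ m)%g \in B by rewrite Bx.
(* Some exponent [i] with [z] in [x ^+ i * B] is picked; the default 0 only serves outside [<[x]> *
   B]. *)
pose psi z := let i := odflt 0%N
  (omap val [pick i : 'I_#[x]%g | ((x ^- i) * z)%g \in B]) in
  chi ((x ^- i) * z)%g + t *+ i.
have cXb i b : b \in B -> commute (x ^+ i)%g b.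
  by move=> Bb; apply/commute_sym/commuteX/commute_sym/(centP cBx).
(* Modulo integers the value does not depend on the exponent: two choices differ by a multiple of
   [m], and [m] times [t] is [chi (x ^+ m)]. *)
have wd i j b d : (i <= j)%N -> b \in B -> d \in B ->
    (x ^+ i * b)%g = (x ^+ j * d)%g -> intq (chi b + t *+ i - (chi d + t *+ j)).
  move=> le_ij Bb Bd eq_ij.
  have Db : b = (x ^+ (j - i) * d)%g.
    by apply: (mulgI (x ^+ i)%g); rewrite mulgA -expgD subnKC.
  have : (m %| j - i)%N by rewrite -Bx -(groupMr _ Bd) -Db.
  case/dvdnP=> u Du.
  have := chiM _ _ (groupX u Bxm) Bd; have := qz_homX chiM u Bxm.
  rewrite -expgM mulnC -Du -Db !intqE => h1 h2.
  have -> : chi b + t *+ i - (chi d + t *+ j) =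
    (chi b - chi (x ^+ (j - i))%g - chi d) + (chi (x ^+ (j - i))%g - chi (x ^+ m)%g *+ u).
    rewrite -{1}(subnKC le_ij) mulrnDr Du mulnC mulrnA -(mulr_natr t m) divfK //.
    ring.
  exact: rpredD.
have psiE i b : b \in B -> intq (psi (x ^+ i * b)%g - (chi b + t *+ i)).
  move=> Bb; rewrite /psi.
  case: pickP => [j Bj | /(_ (Ordinal (ltn_pmod i (order_gt0 x))))] /=; last first.
    by rewrite expg_mod_order mulKg Bb.
  move: {j}(val j) Bj => j; set d := (_ * _)%g => Bd.
  have eq_ij : (x ^+ j * d)%g = (x ^+ i * b)%g by rewrite mulKVg.
  case: (leqP i j) => [le_ij | /ltnW le_ji]; last exact: wd.
  by have := wd _ _ _ _ le_ij Bb Bd (esym eq_ij); rewrite !intqE -rpredN opprB.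
exists psi; split.
- move=> _ _ /mulsgP[_ b /cycleP[i ->] Bb ->] /mulsgP[_ d /cycleP[j ->] Bd ->].
  have := psiE i _ Bb; have := psiE j _ Bd.
  have := psiE (i + j)%N _ (groupM Bb Bd); have := chiM _ _ Bb Bd.
  have -> : (x ^+ (i + j) * (b * d) = x ^+ i * b * (x ^+ j * d))%g.
    by rewrite expgD !mulgA -(mulgA _ _ b) (cXb j b Bb) !mulgA.
  rewrite !intqE => h1 h2 h3 h4.
  set P1 := psi _ in h2 *; set P2 := psi _ in h4 *; set P3 := psi _ in h3 *.
  have -> : P1 - P2 - P3 = (P1 - (chi (b * d)%g + t *+ (i + j)))
    + (chi (b * d)%g - chi b - chi d) - (P3 - (chi d + t *+ j))
    - (P2 - (chi b + t *+ i)) by rewrite mulrnDr; ring.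
  by rewrite rpredB // rpredB // rpredD.
- by move=> b Bb; have := psiE 0%N _ Bb; rewrite expg0 mul1g addr0.
- have := psiE 1%N _ (group1 B); have := qz_hom1 chiM.
  rewrite mulg1 expg1 !intqE => h1 h2.
  have -> : psi x - t = (psi x - (chi 1%g + t *+ 1)) + chi 1%g by rewrite mulr1n; ring.
  exact: rpredD.
Qed.

(* Q/Z is divisible. *)
Lemma qz_hom_extend (gT : finGroupType) (A B : {group gT}) (chi : gT -> rat) :
  abelian A -> B \subset A -> qz_hom B chi ->
  exists psi, qz_hom A psi /\ {in B, forall b, intq (psi b - chi b)}.
Proof.
move=> abA; have [k] := ubnP (#|A| - #|B|).
elim: k => // k IHk in B chi *; rewrite ltnS => le_k sBA chiM.
have [sAB | /subsetPn[x Ax Bx]] := boolP (A \subset B).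
  exists chi; have -> : A = B by apply/group_inj/eqP; rewrite eqEsubset sAB.
  by split=> // b _; rewrite subrr intqE.
have cBx : x \in 'C(B)%g by apply: (subsetP (centS sBA)); apply: (subsetP abA).
have nBx : x \in 'N(B)%g := subsetP (cent_sub B) x cBx.
(* The order of [x] modulo [B] is the order of its coset. *)
have [] := qz_hom_extend1 chiM cBx (order_gt0 (coset B x)).
  move=> i; rewrite order_dvdn -morphX //; apply/idP/eqP => [|/coset_idr].
    exact: coset_id.
  by apply; rewrite groupX.
move=> chi1 [chi1M chi1B _].
have defXB : (<[x]> * B = <[x]> <*> B)%g.
  by rewrite norm_joinEl // cycle_subG.
have sXBA : (<[x]> <*> B)%g \subset A by rewrite join_subG cycle_subG Ax.
rewrite defXB in chi1M.
have ltXB : (#|A| - #|(<[x]> <*> B)%G| < k)%N.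
  apply: leq_trans le_k; rewrite ltn_sub2l //.
    by apply: proper_card; rewrite properE sBA; apply/subsetPn; exists x.
  apply: proper_card; rewrite properE joing_subr; apply/subsetPn; exists x => //.
  by rewrite -cycle_subG joing_subl.
have [psi [psiM psiXB]] := IHk _ _ ltXB sXBA chi1M.
exists psi; split=> // b Bb.
have := chi1B b Bb; have := psiXB b (subsetP (joing_subr _ _) b Bb).
rewrite !intqE => h1 h2; rewrite -[psi b](subrK (chi1 b)) -addrA.
exact: rpredD.
Qed.

Lemma qz_hom_cycle (gT : finGroupType) (c : gT) :
  exists2 chi, qz_hom <[c]>%g chi & intq (chi c - #[c]%g%:R^-1).
Proof.
(* Mapping 1 to the integer 1 instead of 0 makes the extension step from the
   trivial group pick the value 1 / #[c] at c. *)
have one_hom : qz_hom (1%G : {group gT}) (fun=> 1 : rat) by move=> x y _ _; rewrite intqE.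
have [| | |] := @qz_hom_extend1 _ 1%G _ c #[c]%g one_hom.
- by apply/centP=> z /set1P->; rewrite /commute mulg1 mul1g.
- exact: order_gt0.
- by move=> i; rewrite inE order_dvdn.
move=> chi [chiM _ chic]; rewrite mulg1 div1r in chiM chic.
by exists chi.
Qed.

(** * Central extensions and the transgression of a character *)

Section Transgression.

Variables (gT : finGroupType) (G K : {group gT}) (chi : gT -> rat).
Hypotheses (cKG : K \subset 'Z(G)%g) (chiM : qz_hom K chi).

Let r (g : coset_of K) : gT := repr g.

Let rN g : r g \in 'N(K)%g. Proof. exact: repr_coset_norm. Qed.

Let rK g : coset K (r g) = g. Proof. exact: coset_reprK. Qed.

Let factor (g h : coset_of K) : gT := (r g * r h * (r (g * h))^-1)%g.

(** The factor set of the central extension for the section [r], pushed along [chi]. *)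
Definition transgression (g h : coset_of K) : rat := chi (factor g h).

Let nKG : (K <| G)%g. Proof. exact: sub_center_normal. Qed.

Let reprG g : g \in (G / K)%g -> r g \in G.
Proof.
move=> Gg; rewrite -(quotientGK nKG) mem_morphpre ?rN //=.
by rewrite rK.
Qed.

Let cK z x : z \in K -> x \in G -> commute z x.
Proof. by move=> /(subsetP cKG)/centerP[_]; apply. Qed.

Let factorK g h : factor g h \in K.
Proof.
apply: coset_idr; first by rewrite !groupM ?groupV.
rewrite morphM ?groupM ?groupV ?rN // morphM ?rN // morphV ?rN //=.
by rewrite !rK mulgV.
Qed.

Let factorE g h : (factor g h * r (g * h) = r g * r h)%g.
Proof. by rewrite mulgKV. Qed.

(** Associativity of [r g * r h * r k] gives the multiplicative identity [assoc], since [K] is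
    central; [chi] makes it additive. *)
Lemma transgression_cocycle : cocycle2 (G / K)%g transgression.
Proof.
move=> g h k Gg Gh Gk.
have assoc : (factor g h * factor (g * h) k = factor h k * factor g (h * k))%g.
  apply: (mulIg (r (g * h * k)%g)); rewrite -mulgA factorE mulgA factorE.
  rewrite -(mulgA g) -[LHS]mulgA -[RHS]mulgA factorE [RHS]mulgA.
  by rewrite (cK (factorK h k)) ?reprG // -mulgA factorE.
have := chiM (factorK g h) (factorK (g * h) k).
have := chiM (factorK h k) (factorK g (h * k)).
rewrite assoc !intqE /transgression => h1 h2.
set P := chi (_ * _)%g in h1 h2.
rewrite (_ : _ - _ = (P - chi (factor g h) - chi (factor (g * h)%g k))
   - (P - chi (factor h k) - chi (factor g (h * k)%g))); last by ring.
exact: rpredB.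
Qed.

(** If [chi] extends to the preimage of [A], the extension composed with the section [r] is a
    cochain whose coboundary is the transgression. *)
Lemma transgression_split (A : {group coset_of K}) (psi : gT -> rat) :
  A \subset (G / K)%g -> qz_hom (coset K @*^-1 A)%g psi ->
  {in K, forall z, intq (psi z - chi z)} -> coboundary2_on A transgression.
Proof.
move=> sA psiM psiK; exists (fun g => psi (r g)) => g h Ag Ah.
have lift k : k \in A -> r k \in (coset K @*^-1 A)%g.
  by move=> Ak; rewrite mem_morphpre ?rN //= rK.
have sKA : K \subset (coset K @*^-1 A)%g := sub_cosetpre A.
have := psiM _ _ (lift _ Ag) (lift _ Ah); have := psiK _ (factorK g h).
have := psiM _ _ (subsetP sKA _ (factorK g h)) (lift _ (groupM Ag Ah)).
rewrite factorE !intqE /transgression => h1 h2 h3.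
set P := psi (_ * _)%g in h1 h3.
set u := factor g h in h1 h2 *.
have -> : chi u - (psi (r h) - psi (r (g * h)%g) + psi (r g))
  = (P - psi (r g) - psi (r h)) - (P - psi u - psi (r (g * h)%g))
    - (psi u - chi u) by ring.
by rewrite rpredB // rpredB.
Qed.

Lemma transgression_order (e : nat) :
  {in K, forall z, intq (chi z *+ e)} ->
  coboundary2_on (G / K)%g (fun g h => transgression g h *+ e).
Proof.
move=> chie; exists (fun=> 0) => g h _ _.
by rewrite !(subr0, addr0); apply: chie.
Qed.

(** Exactness of the inflation-restriction sequence: a character of [K] with trivial transgression
    is a restriction from [G]. *)
Lemma coboundary_transgression (e : nat) :
  coboundary2_on (G / K)%g (fun g h => transgression g h *+ e) ->
  exists psi, qz_hom G psi /\ {in K, forall z, intq (psi z - chi z *+ e)}.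
Proof.
case=> d dP; pose t x := r (coset K x).
have nK x : x \in G -> x \in 'N(K)%g by apply/subsetP/normal_norm.
have tK x : x \in G -> (x * (t x)^-1)%g \in K.
  move=> Gx; apply: coset_idr; first by rewrite groupM ?groupV ?rN ?nK.
  by rewrite morphM ?groupV ?rN ?nK // morphV ?rN //= rK mulgV.
(* Each [x] is its [K]-part times the chosen representative [t x]; the cochain [d] compensates for
   the failure of [t] to be multiplicative. *)
exists (fun x => chi (x * (t x)^-1)%g *+ e + d (coset K x)); split=> [x y Gx Gy | z Kz].
  have Qx : coset K x \in (G / K)%g by apply: mem_quotient.
  have Qy : coset K y \in (G / K)%g by apply: mem_quotient.
  have := dP _ _ Qx Qy; rewrite -morphM ?nK //=.
  set a := (x * _)%g; set b := (y * _)%g; set u := factor (coset K x) (coset K y).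
  have Ka : a \in K by apply: tK.
  have Kb : b \in K by apply: tK.
  have -> : (x * y * (t (x * y))^-1 = a * b * u)%g.
    rewrite /t morphM ?nK //=; apply: (mulIg (r (coset K x * coset K y)%g)).
    rewrite mulgKV -[RHS]mulgA factorE [RHS]mulgA -(mulgA a) (cK Kb) ?reprG //.
    by rewrite mulgA /a /t mulgKV -mulgA /b /t mulgKV.
  have := chiM (groupM Ka Kb) (factorK (coset K x) (coset K y)).
  have := chiM Ka Kb; rewrite -/u /transgression -/u !intqE => h1 h2 h3.
  set P := chi (a * b * u)%g in h2 *; set d3 := d (coset K (x * y)) in h3 *.
  have -> : P *+ e + d3 - (chi a *+ e + d (coset K x)) - (chi b *+ e + d (coset K y))
    = (P - chi (a * b)%g - chi u) *+ e + (chi (a * b)%g - chi a - chi b) *+ e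
      + (chi u *+ e - (d (coset K y) - d3 + d (coset K x))).
    by rewrite !mulrnBl; ring.
  by apply: rpredD h3; apply: rpredD; apply: rpredMn.
(* On [K] the representative is 1, so it remains that [d 1] is an integer; this is the coboundary
   condition at the pair of identities. *)
have Q1 : 1%g \in (G / K)%g := group1 _.
have := dP _ _ Q1 Q1; have := qz_hom1 chiM.
rewrite /t coset_id // /transgression /factor !mulg1 /r repr_coset1 invg1 !mulg1.
rewrite !intqE => h1 h2.
have -> : chi z *+ e + d 1%g - chi z *+ e
  = chi 1%g *+ e - (chi 1%g *+ e - (d 1%g - d 1%g + d 1%g)) by ring.
by rewrite rpredB // rpredMn.
Qed.

End Transgression.

(* For f in the quotient, k f is a coboundary only if k chi extends to G, where
   it has to be trivial at c. *)
Lemma transgression_class_order (gT : finGroupType) (G : {group gT}) (c : gT)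
    (chi : gT -> rat) :
  c \in 'Z(G)%g -> qz_hom <[c]>%g chi -> intq (chi c - #[c]%g%:R^-1) ->
  (forall psi, qz_hom G psi -> intq (psi c)) ->
  class_order (G / <[c]>)%g (transgression (K := <[c]>%G) chi) #[c]%g.
Proof.
move=> Zc chiM chic G_c; have cZ : (<[c]> \subset 'Z(G))%g by rewrite cycle_subG.
split=> [|k /andP[k_gt0 lt_kq]].
  apply: transgression_order => // z Kz.
  have := qz_homX chiM #[c]%g Kz; have := qz_hom1 chiM.
  rewrite expg_cardG // !intqE => h1 h2; rewrite -(subKr (chi 1%g) (_ *+ _)).
  exact: rpredB.
move/(coboundary_transgression cZ chiM)=> [psi [psiM psiK]].
have := psiK c (cycle_id c); have := G_c _ psiM; move: chic.
set q := #[c]%g in lt_kq *; rewrite !intqE => h1 h2 h3.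
(* Modulo integers, [k / q] is [k] times [chi c], hence [psi c], hence 0; but it lies strictly
   between 0 and 1. *)
have : (k%:R / q%:R : rat) \is a Num.int.
  rewrite (_ : _ / _ = psi c - (psi c - chi c *+ k) - (chi c - q%:R^-1) *+ k).
    by apply: rpredB; [apply: rpredB | apply: rpredMn].
  by rewrite mulrnBl -[_^-1 *+ k]mulr_natl; ring.
have q_gt0 : 0 < q%:R :> rat by rewrite ltr0n order_gt0.
case/intrP=> m Em; have : 0 < m%:~R :> rat by rewrite -Em divr_gt0 ?q_gt0 ?ltr0n.
have : m%:~R < 1 :> rat by rewrite -Em ltr_pdivrMr // mul1r ltr_nat.
by rewrite ltr0z ltrz1; case: m {Em} => [[|m]|m].
Qed.

End Cohomology.

Local Open Scope group_scope.

(** * Morphisms out of the presented group *)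

Section Presented.

Definition class2_gens (gT : finGroupType) (s : seq gT) :=
  {in s & &, forall x y z, [~ x, y, z] = 1}.

Lemma pair_expg (aT bT : finGroupType) (a : aT) (b : bT) m :
  (a, b) ^+ m = (a ^+ m, b ^+ m) :> aT * bT.
Proof. by elim: m => // m IHm; rewrite !expgSr IHm. Qed.

Lemma and_relE (vT : finType) (v1 v2 : vT) (r : Presentation.rel_type) :
  Presentation.and_rel v1 v2 r = (v1 == v2) && r :> bool.
Proof. by case: r => //=; rewrite andbT. Qed.

(** A boolean reading of the relators, so that the conjunction built by [Presentation.rel] can be
    discharged by rewriting. *)
Fixpoint satisfies (gT : finGroupType) (e : seq gT) (f : Presentation.formula) :=
  match f with
  | Presentation.Eq2 s t => Presentation.eval e s == Presentation.eval e t
  | Presentation.And f1 f2 => satisfies e f1 && satisfies e f2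
  end.

Lemma relE (gT : finGroupType) (e : seq gT) f (r : Presentation.rel_type) :
  Presentation.rel e f r = satisfies e f && r :> bool.
Proof.
by elim: f r => [s t|f1 IH1 f2 IH2] r; rewrite /= ?and_relE // IH1 IH2 andbA.
Qed.

Variables (q : nat) (gT : finGroupType) (G : {group gT}) (s1 s2 s3 s4 : gT).

Hypothesis isoG : G \isog Grp (x1 : x2 : x3 : x4 :
    x1 ^+ q, x2 ^+ q, x3 ^+ q, x4 ^+ q,
    [~ x1, x2] ^+ q, [~ x1, x3] ^+ q, [~ x1, x4] ^+ q,
    [~ x2, x3] ^+ q, [~ x2, x4] ^+ q, [~ x3, x4] ^+ q,
    [~ x1, x2, x1], [~ x1, x2, x2], [~ x1, x2, x3], [~ x1, x2, x4],
    [~ x1, x3, x1], [~ x1, x3, x2], [~ x1, x3, x3], [~ x1, x3, x4],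
    [~ x1, x4, x1], [~ x1, x4, x2], [~ x1, x4, x3], [~ x1, x4, x4],
    [~ x2, x3, x1], [~ x2, x3, x2], [~ x2, x3, x3], [~ x2, x3, x4],
    [~ x2, x4, x1], [~ x2, x4, x2], [~ x2, x4, x3], [~ x2, x4, x4],
    [~ x3, x4, x1], [~ x3, x4, x2], [~ x3, x4, x3], [~ x3, x4, x4]).
Hypotheses (genG : <<[set s1; s2; s3; s4]>> = G)
  (rels : schur_rels q s1 s2 s3 s4) (rels2 : class2_gens [:: s1; s2; s3; s4]).

(** The presentation only tells which groups are images of [G]; it does not say where the [s_i] are
    sent. *)
Lemma presented_homg (rT : finGroupType) (x1 x2 x3 x4 : rT) :
  schur_rels q x1 x2 x3 x4 -> class2_gens [:: x1; x2; x3; x4] ->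
  <<[set x1; x2; x3; x4]>> \homg G.
Proof.
move=> [[h1 h2 h3 h4] [[h5 h6 h7 h8 h9] h10]] cl.
have /= -> := isoG <<[set x1; x2; x3; x4]>>%G.
apply/existsP; exists (x1, x2, x3, x4); rewrite and_relE relE andbT /=.
rewrite h1 h2 h3 h4 h5 h6 h7 h8 h9 h10 !cl ?inE ?eqxx ?orbT // !andbT.
rewrite /cycle !joing_idr (joing_idl [set x1]).
by rewrite (joing_idl [set x1; x2]) (joing_idl [set x1; x2; x3]).
Qed.

(* If the x_i satisfy the relations, so do the pairs (s_i, x_i); the group that
   these generate is thus no larger than G, hence is the graph of a morphism. *)
Lemma presented_morphism (rT : finGroupType) (x1 x2 x3 x4 : rT) :
  schur_rels q x1 x2 x3 x4 -> class2_gens [:: x1; x2; x3; x4] ->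
  exists f : {morphism G >-> rT}, [/\ f s1 = x1, f s2 = x2, f s3 = x3 & f s4 = x4].
Proof.
move=> xrels xrels2.
pose S := [set (s1, x1); (s2, x2); (s3, x3); (s4, x4)].
pose L := <<S>>%G.
have homL : L \homg G.
  apply: presented_homg.
    case: rels xrels => [[? ? ? ?] [[? ? ? ? ?] ?]] [[? ? ? ?] [[? ? ? ? ?] ?]].
    by split; [|split; [|]]; rewrite ?pair_expg; try split; congr pair.
  have memS z : z \in [:: (s1, x1); (s2, x2); (s3, x3); (s4, x4)] ->
      z.1 \in [:: s1; s2; s3; s4] /\ z.2 \in [:: x1; x2; x3; x4].
    by rewrite !inE => /or4P[] /eqP->; rewrite !eqxx ?orbT.
  move=> [a b] [c d] [u v] /memS[/= ? ?] /memS[/= ? ?] /memS[/= ? ?].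
  by apply: (@congr2 _ _ _ pair [~ a, c, u] 1 [~ b, d, v] 1); [apply: rels2 | apply: xrels2].
pose fstL := restrm_morphism (subsetT L) (fst_morphism gT rT).
have im_fst : fstL @* L = G.
  rewrite morphim_gen ?subset_gen // morphimEsub ?subset_gen //.
  by rewrite !imsetU !imset_set1.
have inj_fst : 'injm fstL by rewrite -card_im_injm eqn_leq leq_morphim im_fst leq_homg.
have fM : {in G &, {morph (fun y => (invm inj_fst y).2) : y z / y * z}}.
  by move=> y z Gy Gz; rewrite /= morphM ?im_fst.
exists (Morphism fM).
have fE s x : (s, x) \in S -> (invm inj_fst s).2 = x.
  by move=> Sx; rewrite -[s]/(fstL (s, x)) invmE ?mem_gen.
by split; apply: fE; rewrite /S !inE eqxx ?orbT.
Qed.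

End Presented.

(** * Powers of the distinguished element that are commutators *)

Section Wedge.

Import GRing.Theory Num.Theory.

Variables (p n : nat) (gT : finGroupType) (G : {group gT}) (s1 s2 s3 s4 : gT).
Hypotheses (p_pr : prime p) (n_gt0 : (0 < n)%N).
Hypotheses (Gs1 : s1 \in G) (Gs2 : s2 \in G) (Gs3 : s3 \in G) (Gs4 : s4 \in G).
Variable f : {morphism G >-> schur_cover (p ^ n)}.
Hypotheses (f1 : f s1 = cover_gen _ (o4 0)) (f2 : f s2 = cover_gen _ (o4 1))
  (f3 : f s3 = cover_gen _ (o4 2)) (f4 : f s4 = cover_gen _ (o4 3)).

Let q_gt1 : (1 < p ^ n)%N.
Proof. by rewrite -(exp1n n) ltn_exp2r // prime_gt1. Qed.

Definition wedge_sum : gT := (s1 * s2 * s1^-1 * s2^-1) * (s3 * s4 * s3^-1 * s4^-1).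

Let W : 'M['Z_(p ^ n)]_4 := (f wedge_sum).2.

Let Wsum : f wedge_sum = (0%R, W) :> schur_cover (p ^ n).
Proof.
rewrite /W /wedge_sum !morphM ?morphV ?groupM ?groupV //.
by rewrite !cover_commV cover_mulE /= addr0.
Qed.

Let WE (i j : 'I_4) : W i j = ((i < j) && ((i == o4 0) && (j == o4 1)
  || (i == o4 2) && (j == o4 3)))%N%:R%R.
Proof.
rewrite /W /wedge_sum !morphM ?morphV ?groupM ?groupV //.
rewrite !cover_commV cover_mulE /= upper0 addr0 f1 f2 f3 f4.
rewrite !mxE -!val_eqE /= !inordK //.
case: i j => [[|[|[|[|i]]]] //= _] [[|[|[|[|j]]]] //= _];
  by rewrite /= ?mulr1n ?mulr0n; ring.
Qed.

(** The first Pluecker coordinate of the image in the model is 1, so [k] vanishes in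
    ['Z_(p ^ n)]. *)
Lemma wedge_sum_expg_eq1 k : wedge_sum ^+ k = 1 -> (p ^ n %| k)%N.
Proof.
have Gw : wedge_sum \in G by rewrite !groupM ?groupV.
move=> wk1; have := morphX f k Gw; rewrite wk1 morph1 Wsum cover_expg ?upper0 //.
case=> _ /matrixP/(_ (o4 0) (o4 1)); rewrite mulmxnE WE !inordK // !eqxx /= mxE.
by move=> wk0; have := intr_Zp_eq0 k q_gt1; rewrite -[k%:~R%R]wk0 eqxx.
Qed.

(** In the model, a commutator equal to the [k]-th power makes [k] times [W] decomposable, which
    forces [p ^ n] to divide [k]. *)
Lemma comm_wedge_sum x y :
  wedge_sum ^+ (p ^ n) = 1 -> x \in G -> y \in G -> [~ x, y] \in <[wedge_sum]> -> [~ x, y] = 1.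
Proof.
move=> wq Gx Gy /cycleP[k Dk].
have Gw : wedge_sum \in G by rewrite !groupM ?groupV.
have [] : f [~ x, y] = f wedge_sum ^+ k by rewrite Dk morphX.
rewrite morphR // Wsum cover_expg ?upper0 // cover_comm /= => EW.
have q_k : ((p ^ n)%N %| (k : int))%Z.
  pose lift (z : 'Z_(p ^ n)) : int := (z : nat).
  have liftK z : ((lift z)%:~R = z)%R by rewrite /lift -[RHS]natr_Zp.
  apply: (@decomposable_multiple p n (fun i j => lift (W i j))
    (fun i => lift ((f x).1 0%R i)) (fun i => lift ((f y).1 0%R i))) => // [|i j lt_ij].
    (* The only nonzero coordinates of [W] are the two ones at 01 and 23, so the Pfaffian is 1. *)
    rewrite !WE /lift !inordK //= -!val_eqE /= !inordK //=.
    by rewrite Zp_cast // modn_small // dvdzE dvdn1 neq_ltn prime_gt1 ?orbT.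
  rewrite -intr_Zp_eq0 // !(rmorphB, rmorphM) /= !liftK.
  case: EW => _ /matrixP/(_ i j); rewrite mulmxnE !mxE lt_ij => EW.
  by rewrite [X in (_ - X - _)%R]mulrC EW mulr_natl subrr.
have /dvdnP[u Du] : (p ^ n %| k)%N := q_k.
by rewrite Dk Du mulnC expgM wq expg1n.
Qed.
End Wedge.

(** The triple commutator relators make commutators of generators central. The element [c] is
    spelled out because [[~ x, y]] stands for [x^-1 * y^-1 * x * y]. *)
Theorem theorem5p4 (p n : nat) (gT : finGroupType) (Gt : {group gT})
    (s1 s2 s3 s4 : gT) :
  prime p -> (0 < n)%N ->
  Gt \isog Grp (x1 : x2 : x3 : x4 :
    x1 ^+ (p ^ n), x2 ^+ (p ^ n), x3 ^+ (p ^ n), x4 ^+ (p ^ n),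
    [~ x1, x2] ^+ (p ^ n), [~ x1, x3] ^+ (p ^ n), [~ x1, x4] ^+ (p ^ n),
    [~ x2, x3] ^+ (p ^ n), [~ x2, x4] ^+ (p ^ n), [~ x3, x4] ^+ (p ^ n),
    [~ x1, x2, x1], [~ x1, x2, x2], [~ x1, x2, x3], [~ x1, x2, x4],
    [~ x1, x3, x1], [~ x1, x3, x2], [~ x1, x3, x3], [~ x1, x3, x4],
    [~ x1, x4, x1], [~ x1, x4, x2], [~ x1, x4, x3], [~ x1, x4, x4],
    [~ x2, x3, x1], [~ x2, x3, x2], [~ x2, x3, x3], [~ x2, x3, x4],
    [~ x2, x4, x1], [~ x2, x4, x2], [~ x2, x4, x3], [~ x2, x4, x4],
    [~ x3, x4, x1], [~ x3, x4, x2], [~ x3, x4, x3], [~ x3, x4, x4]) ->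
  <<[set s1; s2; s3; s4]>> = Gt ->
  schur_rels (p ^ n) s1 s2 s3 s4 ->
  'Z(Gt) = [~: Gt, Gt] ->
  let c := (s1 * s2 * s1^-1 * s2^-1) * (s3 * s4 * s3^-1 * s4^-1) in
  B0_has_cyclic (Gt / <[c]>)%G (p ^ n).
Proof.
move=> p_pr n_gt0 isoG genG rels ZG c.
have q_gt1 : (1 < p ^ n)%N by rewrite -(exp1n n) ltn_exp2r // prime_gt1.
have [Gs1 Gs2 Gs3 Gs4] : [/\ s1 \in Gt, s2 \in Gt, s3 \in Gt & s4 \in Gt].
  by rewrite -genG; split; apply: mem_gen; rewrite !inE eqxx ?orbT.
have Zcomm x y : x \in Gt -> y \in Gt -> [~ x, y] \in 'Z(Gt).
  by move=> Gx Gy; rewrite ZG mem_commg.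
have cent z x : z \in 'Z(Gt) -> x \in Gt -> commute z x.
  by move=> /centerP[_ cz] /cz.
have Gs z : z \in [:: s1; s2; s3; s4] -> z \in Gt.
  by rewrite !inE => /or4P[] /eqP->.
have cl2 : class2_gens [:: s1; s2; s3; s4].
  move=> x y z /Gs Gx /Gs Gy /Gs Gz; apply/eqP/commgP.
  exact: cent (Zcomm _ _ Gx Gy) Gz.
have [f [f1 f2 f3 f4]] := presented_morphism isoG genG rels cl2
  (cover_gen_rels (o4 0) (o4 1) (o4 2) (o4 3) q_gt1)
  (fun x y z _ _ _ => cover_comm3 x y z).
(* The two commutator conventions coincide because commutators are central. *)
have commV x y : x \in Gt -> y \in Gt -> x * y * x^-1 * y^-1 = [~ x, y].
  move=> Gx Gy; have E : [~ x, y] * (y * x) = y * x * [~ x, y].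
    by apply: cent; rewrite ?Zcomm ?groupM.
  by rewrite [x * y]commgC -E -mulgA -invMg mulgK.
have Dc : c = [~ s1, s2] * [~ s3, s4] by rewrite /c !commV.
have Zc : c \in 'Z(Gt) by rewrite Dc groupM ?Zcomm.
have cZ : <[c]> \subset 'Z(Gt) by rewrite cycle_subG.
(* The relations bound the order from above, and the image of [c] in the model bounds it from
   below. *)
have oc : #[c] = (p ^ n)%N.
  apply/eqP; rewrite eqn_dvd order_dvdn; apply/andP; split.
    case: rels => _ [[w12 _ _ _ _] w34].
    rewrite Dc expgMn; first by rewrite w12 w34 mulg1.
    by apply: cent; rewrite ?Zcomm ?groupR.
  by apply: (wedge_sum_expg_eq1 p_pr n_gt0 Gs1 Gs2 Gs3 Gs4 f1 f2 f3 f4); rewrite // expg_order.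
have comm1 x y : x \in Gt -> y \in Gt -> [~ x, y] \in <[c]> -> [~ x, y] = 1.
  by apply: (comm_wedge_sum p_pr n_gt0 Gs1 Gs2 Gs3 Gs4 f1 f2 f3 f4); rewrite -/c -oc expg_order.
have [chi chiM chic] := qz_hom_cycle c.
have nK : <[c]> <| Gt := sub_center_normal cZ.
exists (transgression chi); split; [split|].
- exact: transgression_cocycle.
- move=> A sA [x [y defA]].
  have abA : abelian A.
    by case/dprodP: defA => _ <- cxy _; rewrite abelianM !cycle_abelian //.
  have sAG : coset <[c]> @*^-1 A \subset Gt.
    by rewrite -(quotientGK nK) morphpreS.
  (* Lifts of elements of [A] have commutators in [<[c]>], and these are trivial by [comm1]. *)
  have ab : abelian (coset <[c]> @*^-1 A).
    apply/centsP=> u Au v Av; apply/commgP/eqP; apply: comm1.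
    - exact: (subsetP sAG).
    - exact: (subsetP sAG).
    have [/morphpreP[Nu Qu] /morphpreP[Nv Qv]] := (Au, Av).
    apply: coset_idr; first by rewrite groupR.
    by rewrite morphR //; apply/eqP/commgP; apply: (centsP abA).
  have [psi [psiM psiK]] := qz_hom_extend ab (sub_cosetpre A) chiM.
  exact: (transgression_split sA psiM psiK).
(* It remains that every character of [Gt] is trivial at [c], a product of two commutators. *)
rewrite -oc; apply: transgression_class_order => // psi psiM.
by apply: (qz_homM_intq psiM); rewrite ?(qz_hom_comm psiM) ?groupM ?groupV.
Qed.
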